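(* Let $\mathcal G$ be an $(n,c,k,\mu)$-admissible hypergraph. Then $\mathcal G$ has a spanning Euler tour if at least one of the following holds: (i) $\delta_2(\mathcal G)\ge k$; (ii) $\delta_3(\mathcal G)\ge 1$ and $n\ge k^2-3k+5$; (iii) $\delta_r(\mathcal G)\ge 1$ for some integer $r$ with $4\le r\le k$.
   Context: A hypergraph $\mathcal G=(V,E)$ consists of a finite vertex set $V$ and a finite multiset $E$ of nonempty subsets of $V$ (edges; repeated edges allowed). $\mu(\mathcal G)$ is the maximum multiplicity of an edge in $E$; $\operatorname{rk}(\mathcal G)=\max\{|e|:e\in E\}$, $\operatorname{crk}(\mathcal G)=\min\{|e|:e\in E\}$. For $T\subseteq V$, $\deg(T)$ is the number of edges (counted with multiplicity) containing $T$, and $\delta_t(\mathcal G)=\min\{\deg(T):T\subseteq V,|T|=t\}$. An $n$-vertex hypergraph $\mathcal G$ is $(n,c,k,\mu)$-admissible if $\operatorname{crk}(\mathcal G)=c\ge 3$, $\operatorname{rk}(\mathcal G)=k$, $\mu(\mathcal G)=\mu$, and $n\ge g(c,k,\mu)$, where $g(3,3,\mu)=7$; $g(3,4,\mu)=10$; $g(c,k,\mu)=\binom{k}{2}+1$ if $c\ge 4$ and $k\le 2c-2$; $g(c,k,\mu)=(4c^2+k^2-3k+2)/(4c-2k+2)$ if $c\ge3$ and $2c-1\le k\le 2c$; and $g(c,k,\mu)=2\mu(k-1)(2^{k-c-1}-2^c+1)+\binom{k}{2}+1$ if $k>2c$. A closed walk is a cyclic sequence $v_1,e_1,v_2,e_2,\dots,v_t,e_t$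 of vertices and edges with $\{v_i,v_{i+1}\}\subseteq e_i$ and $v_i\ne v_{i+1}$ for all $i$ (indices modulo $t$). An Euler tour is a closed walk in which every edge of $\mathcal G$ (each member of the multiset $E$) occurs exactly once among $e_1,\dots,e_t$; it is spanning if every vertex of $\mathcal G$ occurs among $v_1,\dots,v_t$. *)

(* Defs.v *)
From mathcomp Require Import all_boot all_order all_algebra.
Set Implicit Arguments. Unset Strict Implicit. Unset Printing Implicit Defensive.
Import Order.TTheory GRing.Theory Num.Theory.

(* A hypergraph on the finite vertex type V with m edges: the multiset E is
   given by an indexing  e : 'I_m -> {set V}  (repeated edges allowed). *)

Section Hyper.
Variables (V : finType) (m : nat) (e : 'I_m -> {set V}).

Definition mult (f : {set V}) : nat := #|[set i : 'I_m | e i == f]|.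

Definition deg (T : {set V}) : nat := #|[set i : 'I_m | T \subset e i]|.

Definition delta_ge (t d : nat) : Prop :=
  forall T : {set V}, #|T| = t -> d <= deg T.

Definition is_crk (c : nat) : Prop :=
  (exists i, #|e i| = c) /\ forall i, c <= #|e i|.
Definition is_rk (k : nat) : Prop :=
  (exists i, #|e i| = k) /\ forall i, #|e i| <= k.
Definition is_mu (mu : nat) : Prop :=
  (exists i, mult (e i) = mu) /\ forall i, mult (e i) <= mu.

(* A closed walk v_1,e_1,...,v_t,e_t is encoded as the cyclic sequence of
   pairs (v_i, e_i); consecutive pairs (v,f),(v',_) must satisfy
   {v,v'} \subset f and v != v' (cyclically, via [cycle]). *)
Definition walk_step (x y : V * 'I_m) : bool :=
  [&& x.1 \in e x.2, y.1 \in e x.2 & x.1 != y.1].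

Definition closed_walk (w : seq (V * 'I_m)) : Prop := cycle walk_step w.

Definition euler_tour (w : seq (V * 'I_m)) : Prop :=
  closed_walk w /\ perm_eq (map snd w) (enum 'I_m).

Definition spanning (w : seq (V * 'I_m)) : Prop :=
  forall v : V, v \in map fst w.

Definition has_spanning_euler_tour : Prop :=
  exists w, euler_tour w /\ spanning w.

End Hyper.

Local Open Scope ring_scope.

Definition g (c k mu : nat) : rat :=
  if (c == 3%N) && (k == 3%N) then 7
  else if (c == 3%N) && (k == 4%N) then 10
  else if (4 <= c)%N && (k <= 2 * c - 2)%N then ('C(k, 2)).+1%:R
  else if (3 <= c)%N && (2 * c - 1 <= k)%N && (k <= 2 * c)%N then
    ((4 * c ^ 2 + k ^ 2 + 2)%:R - (3 * k)%:R) / ((4 * c + 2)%:R - (2 * k)%:R)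
  else if (3 <= c)%N && (2 * c < k)%N then
    (2 * mu * (k - 1))%:R * (2 ^+ (k - c - 1) - 2 ^+ c + 1) + ('C(k, 2)).+1%:R
  else 0.

Local Close Scope ring_scope.

Definition admissible (V : finType) (m : nat) (e : 'I_m -> {set V})
  (n c k mu : nat) : Prop :=
  #|V| = n /\ (forall i, e i != set0) /\ 3 <= c /\ is_crk e c /\ is_rk e k /\
  is_mu e mu /\ (g c k mu <= n%:R :> rat)%R.

(* Main.v *)
Require Import Defs.
From mathcomp Require Import all_boot all_order all_algebra.
From mathcomp Require Import zify ring lra.
From Stdlib Require Import Classical.
Set Implicit Arguments. Unset Strict Implicit. Unset Printing Implicit Defensive.
Import Order.TTheory GRing.Theory Num.Theory.

(* Under (ii) or (iii), counting the edges through a pair gives delta_2 >= k, and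
   the bound on n gives n >= 'C(k, 2) + 1 >= 2 (k - 1). These two facts suffice.

   An Euler tour amounts to choosing a pair of vertices in every edge so that the
   chosen pairs form a connected graph with all degrees even. Take two copies of
   F_2^V and represent a pair uv of colour i by the vector 1_u + 1_v in copy i. By
   Rado's theorem on independent transversals, one can choose a coloured pair in
   every edge so that the pairs of each colour span the even vectors (connect V)
   as soon as, for every subspace P, the number of edges having a coloured pair
   outside P is at least 2 (n - 1) - dim P =: q. Now for each u at least q / 2
   vertices v have uv outside P in some colour; each such pair lies in at least k
   edges and each edge contains at most k (k - 1) ordered pairs, so there are at
   least n q / (2 (k - 1)) >= q such edges.

   Keep the pairs of the first colour. For an edge whose pair uv has the second
   colour, take a third vertex z of the edge and use zu or zv instead: switching
   between them adds 1_u + 1_v to the vector of degrees mod 2, and since these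
   vectors span the even vectors all degrees can be made even. *)

(** * Rado's theorem on transversals spanning a vector space *)

Section Rado.
Variables (K : fieldType) (vT : vectType K) (I X : finType).
Variables (phi : X -> vT) (P0 : {vspace vT}).

Definition outside (A : I -> {set X}) (P : {vspace vT}) : {set I} :=
  [set i | [exists x in A i, phi x \notin P]].

(** Rado's condition in the quotient by [P0]; the application takes [root_span r] for [P0]. *)
Definition spanning_cond (A : I -> {set X}) : Prop :=
  forall P : {vspace vT}, (P0 <= P)%VS -> \dim {:vT} <= \dim P + #|outside A P|.

Lemma outsidePn (A : I -> {set X}) (P : {vspace vT}) i :
  reflect (forall x, x \in A i -> phi x \in P) (i \notin outside A P).
Proof.
rewrite inE negb_exists_in; apply: (iffP forall_inP) => h x /h; by rewrite negbK.
Qed.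

(* Strictness at i0 is what contradicts tightness of both P and Q in [rado_span]. *)
Lemma outside_cap_add (A : I -> {set X}) (P Q : {vspace vT}) i0 :
  i0 \in outside A P -> i0 \in outside A Q -> i0 \notin outside A (P + Q)%VS ->
  #|outside A (P :&: Q)%VS| + #|outside A (P + Q)%VS| < #|outside A P| + #|outside A Q|.
Proof.
move=> hP hQ hPQ.
have sub1 : outside A (P :&: Q)%VS \subset outside A P :|: outside A Q.
  apply/subsetP => i; apply: contraLR; rewrite !in_setU negb_or => /andP[].
  move=> /outsidePn h1 /outsidePn h2; apply/outsidePn => x xA.
  by rewrite memv_cap h1 // h2.
have sub2 : outside A (P + Q)%VS \proper outside A P :&: outside A Q.
  apply/properP; split; last by exists i0; rewrite // in_setI hP.
  apply/subsetP => i; apply: contraLR; rewrite in_setI negb_and.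
  case/orP=> /outsidePn h; apply/outsidePn => x /h.
  - exact/subvP/addvSl.
  - exact/subvP/addvSr.
rewrite -[X in _ < X]cardsUI -addnS; apply: leq_add.
  exact: subset_leq_card.
exact: proper_card.
Qed.

Definition trim (A : I -> {set X}) i x j := if j == i then A i :\ x else A j.

(** Deleting x can remove only i from [outside A P]. So a subspace that violates the condition
    afterwards was tight before, and x alone put i outside it. *)
Lemma trim_fails (A : I -> {set X}) i x :
  spanning_cond A -> ~ spanning_cond (trim A i x) ->
  exists P : {vspace vT}, [/\ (P0 <= P)%VS, \dim {:vT} = \dim P + #|outside A P|,
    i \in outside A P & forall y, y \in A i -> y != x -> phi y \in P].
Proof.
move=> condA /not_all_ex_not[P ncond].
have [P0P /negP] := imply_to_and _ _ ncond; rewrite -ltnNge => lt.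
have sub : outside (trim A i x) P \subset outside A P.
  apply/subsetP => j; rewrite !inE => /exists_inP[y yA yP]; apply/exists_inP; exists y => //.
  by move: yA; rewrite /trim; case: eqP => // ->; rewrite in_setD1 => /andP[].
have sub' : outside A P \subset i |: outside (trim A i x) P.
  apply/subsetP => j; rewrite in_setU1; case: eqVneq => //= ji.
  by rewrite !inE /trim (negPf ji).
have condP := condA P P0P.
have iN : i \notin outside (trim A i x) P.
  apply/negP => iT; have: outside A P \subset outside (trim A i x) P.
    by apply: (subset_trans sub'); rewrite subUset sub1set iT subxx.
  by move/subset_leq_card; rewrite -(leq_add2l (\dim P)) => /(leq_trans condP); rewrite leqNgt lt.
have le1 := subset_leq_card sub'; rewrite cardsU1 iN /= add1n in le1.
exists P; split=> //.
- apply/eqP; rewrite eqn_leq condP /=.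
  by apply: leq_trans lt; rewrite -addnS leq_add2l.
- apply: contraTT lt => iA; rewrite -leqNgt; apply: leq_trans condP _.
  rewrite leq_add2l subset_leq_card //; apply/subsetP => j jA.
  move/subsetP/(_ j jA): sub'; rewrite in_setU1 => /orP[/eqP eji|//].
  by rewrite eji (negPf iA) in jA.
- move=> y yA yx; move/outsidePn: iN; apply.
  by rewrite /trim eqxx in_setD1 yx.
Qed.

(** Shrink the sets while the condition survives. If neither x nor y can be deleted from [A i], the
    tight P and Q have a sum containing the image of [A i], so [outside_cap_add] applies. As dim (P
    :&: Q) + dim (P + Q) = dim P + dim Q, this contradicts the condition for P :&: Q and P + Q. *)
Lemma rado_span (A : I -> {set X}) :
  (forall i, A i != set0) -> spanning_cond A ->
  exists2 f : I -> X, (forall i, f i \in A i) &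
    (P0 + \sum_i <[phi (f i)]>)%VS = fullv.
Proof.
have [N] := ubnP (\sum_i #|A i|); elim: N A => // N IHN A leN A0 condA.
case: (pickP (fun i => 1 < #|A i|)) => [i /card_gt1P[x [y [xA yA xy]]]|all1]; last first.
  have /fin_all_exists[f fA] i : exists x, x \in A i by apply/set0Pn.
  exists f => //; apply/eqP; rewrite eqEdim subvf /=.
  (* All sets are singletons here, so nothing lies outside the span P and the condition makes P
     full. *)
  set P := (_ + _)%VS; have := condA P (addvSl _ _).
  suff -> : outside A P = set0 by rewrite cards0 addn0.
  apply/setP => i; rewrite in_set0; apply/negbTE/outsidePn => x xA.
  have fP : phi (f i) \in P.
    apply: (subvP (addvSr P0 _)).
    by apply: (subvP (sumv_sup i isT (subvv _))); exact: memv_line.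
  suff -> : x = f i by [].
  have := all1 i; apply: contraFeq => xf; apply/card_gt1P; exists x, (f i); split=> //.
have trim_ok z : z \in A i -> (exists2 z', z' \in A i & z' != z) -> spanning_cond (trim A i z) ->
    exists2 f : I -> X, (forall i, f i \in A i) &
    (P0 + \sum_i <[phi (f i)]>)%VS = fullv.
  move=> zA [z' z'A z'z] condz.
  have sub j : trim A i z j \subset A j.
    by rewrite /trim; case: eqP => [->|//]; exact: subsetDl.
  have [] := IHN (trim A i z) _ _ condz.
  - rewrite -ltnS; apply: leq_trans leN; rewrite ltnS.
    rewrite (bigD1 i) //= [X in _ < X](bigD1 i) //= -addSn leq_add //.
      by rewrite /trim eqxx [X in _ <= X](cardsD1 z) zA.
    by apply: leq_sum => j _; exact: subset_leq_card.
  - move=> j; rewrite /trim; case: (j =P i) => // _; apply/set0Pn; exists z'.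
    by rewrite in_setD1 z'z.
  by move=> f fA fspan; exists f => // j; exact: (subsetP (sub j)).
case: (classic (spanning_cond (trim A i x))) => [|badx].
  by apply: trim_ok => //; exists y; rewrite // eq_sym.
case: (classic (spanning_cond (trim A i y))) => [|bady].
  by apply: trim_ok => //; exists x.
have [P [P0P tP iP hP]] := trim_fails condA badx.
have [Q [P0Q tQ iQ hQ]] := trim_fails condA bady.
have iPQ : i \notin outside A (P + Q)%VS.
  apply/outsidePn => z zA; have [zx|zx] := eqVneq z x.
    by apply: (subvP (addvSr P Q)); apply: hQ => //; rewrite zx.
  by apply: (subvP (addvSl P Q)); exact: hP.
have := outside_cap_add iP iQ iPQ.
have c1 := condA (P :&: Q)%VS; rewrite subv_cap P0P P0Q in c1.
have c2 := condA (P + Q)%VS (subv_trans P0P (addvSl _ _)).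
have := leq_add (c1 isT) c2.
rewrite {1}tP {1}tQ addnACA [X in _ <= X]addnACA [\dim (P :&: Q) + _]addnC dimv_sum_cap.
by rewrite leq_add2l leqNgt => /negPf ->.
Qed.
End Rado.

(** * Euler circuits in connected even multigraphs *)

Section Euler.
Variables (V I : finType) (a b : I -> V).

(* A dart (i, d) is the edge i traversed from a i to b i, or backwards if d. *)
Definition dart_src (d : I * bool) : V := if d.2 then b d.1 else a d.1.
Definition dart_tgt (d : I * bool) : V := if d.2 then a d.1 else b d.1.
Definition dart_step (d d' : I * bool) : bool := dart_tgt d == dart_src d'.
Definition trail (w : seq (I * bool)) : bool :=
  sorted dart_step w && uniq (map fst w).

(** A column of the incidence matrix over F_2: sums over edges are degrees mod 2. *)
Definition ends (i : I) (v : V) : 'F_2 := ((a i == v)%:R + (b i == v)%:R)%R.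

Lemma endsE d v : ends d.1 v = ((dart_src d == v)%:R + (dart_tgt d == v)%:R)%R.
Proof. by case: d => i [] //; rewrite /ends /dart_src /dart_tgt /= addrC. Qed.

Lemma ends_neq0 i v : ends i v != 0%R -> exists2 d, d.1 = i & dart_src d = v.
Proof.
rewrite /ends; case: (a i =P v) => [av _|_]; first by exists (i, false); rewrite // -av.
by case: (b i =P v) => [bv _|_]; [exists (i, true); rewrite // -bv | rewrite addr0 eqxx].
Qed.

Lemma addrr_F2 (x : 'F_2) : (x + x = 0)%R.
Proof. exact: addrr_pchar2. Qed.

Lemma sum_ends_path d w v : path dart_step d w ->
  (\sum_(x <- d :: w) ends x.1 v =
   (dart_src d == v)%:R + (dart_tgt (last d w) == v)%:R)%R.
Proof.
elim: w d => [|d' w IHw] d /=; first by rewrite big_seq1 endsE.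
case/andP=> /eqP dd' /IHw; rewrite big_cons => ->.
by rewrite endsE dd' -addrA [X in (_ + X)%R]addrA addrr_F2 add0r.
Qed.

(** A longest trail is closed by parity. Its rotations are longest trails too, so every edge at a
    visited vertex is used, and connectivity yields all vertices. *)
Lemma euler_circuit :
  0 < #|I| -> (forall v, (\sum_i ends i v = 0)%R) ->
  (forall S : {set V}, S != set0 -> S != setT ->
     exists i, (a i \in S) != (b i \in S)) ->
  exists w, [/\ cycle dart_step w, perm_eq (map fst w) (enum I) &
    forall v, v \in map dart_src w].
Proof.
move=> I0 even conn.
pose has_trail n := [exists t : n.-tuple (I * bool), trail t].
have has_trailP w : trail w -> has_trail (size w).
  by move=> tw; apply/existsP; exists (in_tuple w).
have exP : exists n, has_trail n by exists 0; exact: (has_trailP [::]).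
have ubP n : has_trail n -> n <= #|I|.
  case/existsP=> t /andP[_ /card_uniqP eq]; rewrite -(size_tuple t) -(size_map fst) -eq.
  exact: max_card.
case: (ex_maxnP exP ubP) => N /existsP[t tt] maxN.
have maxw w : trail w -> size w <= N by move/has_trailP/maxN.
case: t tt => w /= /eqP sw /andP[pw uw]; subst N.
(* Stated for every trail as long as [w], because it is applied to rotations of [w]. *)
have ext d' w' x : size (d' :: w') = size w -> path dart_step d' w' ->
    uniq (map fst (d' :: w')) -> dart_src x = dart_tgt (last d' w') -> x.1 \in map fst (d' :: w').
  move=> sz p' u' ex; apply: contraT => nx.
  suff /maxw : trail (d' :: rcons w' x) by rewrite /= size_rcons -sz /= ltnn.
  by rewrite /trail -rcons_cons map_rcons rcons_uniq nx u' /= rcons_path p' /dart_step ex eqxx.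
case: w pw uw maxw ext {has_trailP exP ubP maxN} => [|d w] pw uw maxw ext.
  have /card_gt0P[i _] := I0.
  by have /maxw := (erefl : trail [:: (i, false)]).
rewrite [sorted _ _]/= in pw.
have closed : dart_tgt (last d w) = dart_src d.
  apply/eqP; apply: contraT => open.
  set v := dart_tgt (last d w) in open *.
  have used : (\sum_(i in map fst (d :: w)) ends i v = 1)%R.
    by rewrite -big_uniq // big_map (@sum_ends_path d w v pw) eqxx eq_sym (negPf open) add0r.
  case: (pickP [pred i | (i \notin map fst (d :: w)) && (ends i v != 0%R)]) => [i|none].
    case/andP=> nu /ends_neq0[x xi sx].
    by have := ext d w x erefl pw uw sx; rewrite xi (negPf nu).
  have := even v; rewrite (bigID [in map fst (d :: w)]) /= used big1 ?addr0 // => i nu.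
  by have := none i; rewrite /= nu => /negbFE/eqP.
have cyc : cycle dart_step (d :: w).
  by rewrite /= rcons_path pw /dart_step closed eqxx.
pose S := [set v | v \in map dart_src (d :: w)].
have tgtS x : x \in d :: w -> dart_tgt x \in S.
  move=> xw; have := next_cycle cyc xw; rewrite inE => /eqP ->.
  by rewrite map_f // mem_next.
have usedS i : i \in map fst (d :: w) -> (a i \in S) && (b i \in S).
  case/mapP=> x xw ->; have := tgtS x xw.
  have : dart_src x \in S by rewrite inE map_f.
  by case: x {xw} => j [] /=; rewrite /dart_src /dart_tgt /= => -> ->.
have touch x : dart_src x \in S -> x.1 \in map fst (d :: w).
  rewrite inE => /mapP[y yw eqy].
  have [n w' rw] := rot_to yw.
  have : cycle dart_step (rot n (d :: w)) by rewrite rot_cycle.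
  rewrite rw /= rcons_path => /andP[py /eqP ly].
  have -> : (x.1 \in map fst (d :: w)) = (x.1 \in map fst (y :: w')).
    by rewrite -rw map_rot mem_rot.
  apply: ext => //.
  - by rewrite -rw size_rot.
  - by rewrite -rw map_rot rot_uniq.
  - by rewrite ly.
have ST : S = setT.
  apply/eqP; apply: contraT => /conn[|i].
    by apply/set0Pn; exists (dart_src d); rewrite inE mem_head.
  case aS: (a i \in S).
    by have /usedS/andP[_ ->] := touch (i, false) aS.
  case bS: (b i \in S) => //.
  by have := touch (i, true) bS => /usedS; rewrite aS.
exists (d :: w); split=> // [|v].
  rewrite uniq_perm ?enum_uniq // => i.
  by rewrite mem_enum (touch (i, false)) // ST in_setT.
by have := in_setT v; rewrite -ST inE.
Qed.
End Euler.

(** * Coloured pairs and the verification of Rado's condition *)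

Lemma card_offdiag (T : finType) (S : {set T}) :
  #|[set p : T * T | [&& p.1 \in S, p.2 \in S & p.1 != p.2]]| = #|S| * #|S|.-1.
Proof.
rewrite -sum1_card (eq_bigl (fun p : T * T => (p.1 \in S) && (p.2 \in S :\ p.1))); last first.
  by move=> p; rewrite inE in_setD1 eq_sym (andbC (p.2 \in S)).
rewrite -(pair_big_dep (mem S) (fun x y => y \in S :\ x) (fun _ _ => 1)) /= -sum_nat_const.
by apply: eq_bigr => x xS; rewrite sum1_card (cardsD1 x S) xS.
Qed.

Section Links.
Variable V : finType.
Let vT := {ffun bool * V -> ('F_2)^o}.
Local Open Scope ring_scope.

Definition unit_vec (j : bool * V) : vT := [ffun j' => (j' == j)%:R].
(* The pair x.1.2, x.2 as an edge of the copy of the complete graph on V of colour x.1.1. *)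
Definition link (x : bool * V * V) : vT := unit_vec x.1 + unit_vec (x.1.1, x.2).

Lemma unit_vec_sum (w : vT) : w = \sum_j w j *: unit_vec j.
Proof.
apply/ffunP => j; rewrite sum_ffunE (bigD1 j) //= big1 => [|j' j'j].
  by rewrite !ffunE eqxx addr0 [_ *: _]mulr1.
by rewrite !ffunE eq_sym (negPf j'j) [_ *: _]mulr0.
Qed.

Lemma fullv_unit_vec (P : {vspace vT}) : (forall j, unit_vec j \in P) -> P = fullv.
Proof.
move=> h; apply/eqP; rewrite eqEsubv subvf; apply/subvP => w _.
by rewrite (unit_vec_sum w) memv_suml // => j _; rewrite memvZ.
Qed.

Lemma addvv_F2 (w : vT) : w + w = 0.
Proof. by apply/ffunP => j; rewrite !ffunE; exact: addrr_F2. Qed.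

Lemma unit_vec_link u v r i :
  unit_vec (i, v) = link (i, u, v) + link (i, u, r) + unit_vec (i, r).
Proof.
by rewrite /link /= addrACA addvv_F2 add0r -addrA addvv_F2 addr0.
Qed.

(* Links only span the vectors of even weight in each copy, of codimension 1. *)
Definition root_span r : {vspace vT} := (<[unit_vec (false, r)]> + <[unit_vec (true, r)]>)%VS.

Lemma mem_root_span r i : unit_vec (i, r) \in root_span r.
Proof.
case: i; [apply: (subvP (addvSr _ _)) | apply: (subvP (addvSl _ _))]; exact: memv_line.
Qed.

Definition unlinked (P : {vspace vT}) u : {set V} :=
  [set v | ~~ ((link (false, u, v) \in P) && (link (true, u, v) \in P))].

(** Modulo the two root vectors, the links at u in both colours span everything, and each v in
    [unlinked P u] adds at most two dimensions to P. *)
Lemma dim_unlinked (P : {vspace vT}) r u : (root_span r <= P)%VS ->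
  (\dim {:vT} <= \dim P + 2 * #|unlinked P u|)%N.
Proof.
move=> rP.
pose Q := (\sum_(v in unlinked P u) (<[link (false, u, v)]> + <[link (true, u, v)]>))%VS.
have linkPQ i v : link (i, u, v) \in (P + Q)%VS.
  case vN: (v \in unlinked P u).
    apply: (subvP (addvSr P Q)); apply: (subvP (sumv_sup v vN (subvv _))).
    by case: i; [apply: (subvP (addvSr _ _)) | apply: (subvP (addvSl _ _))]; exact: memv_line.
  apply: (subvP (addvSl P Q)); move: vN; rewrite inE => /negbFE/andP[]; by case: i.
have <- : (P + Q)%VS = fullv.
  apply: fullv_unit_vec => -[i v]; rewrite (unit_vec_link u v r).
  apply: memvD; first exact: memvD.
  apply: (subvP (addvSl P Q)); apply: (subvP rP); exact: mem_root_span.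
apply: (leq_trans (dimv_add_leqif _ _)); rewrite leq_add2l.
apply: (leq_trans (dimv_leq_sum _ _ _)); rewrite mulnC -sum_nat_const; apply: leq_sum => v _.
apply: (leq_trans (dimv_add_leqif _ _)).
by rewrite !dim_vline; do 2!case: eqP.
Qed.

Variables (m : nat) (e : 'I_m -> {set V}).

Definition choices (i : 'I_m) : {set bool * V * V} :=
  [set x | [&& x.1.2 \in e i, x.2 \in e i & x.1.2 != x.2]].

Lemma choices_spanning k r : (0 < k)%N -> (forall i, #|e i| <= k)%N -> delta_ge e 2 k ->
  (2 * k.-1 <= #|V|)%N -> spanning_cond link (root_span r) choices.
Proof.
move=> k0 rk d2 nk P rP; set C := outside _ _ _.
pose deg2 (p : V * V) := #|[set i | (p.1 \in e i) && (p.2 \in e i)]|.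
(* Double counting of the unlinked ordered pairs against the edges of C containing them. *)
have count : (k * \sum_u #|unlinked P u| <= k * (k.-1 * #|C|))%N.
  have -> : (\sum_u #|unlinked P u| = \sum_(p | p.2 \in unlinked P p.1) 1)%N.
    rewrite -(pair_big_dep predT (fun u v => v \in unlinked P u) (fun _ _ => 1%N)) /=.
    by apply: eq_bigr => u _; rewrite sum1_card.
  rewrite big_distrr /= [leqRHS]mulnA [leqRHS]mulnC -sum_nat_const.
  have neq p : p.2 \in unlinked P p.1 -> p.1 != p.2.
    rewrite inE; apply: contraNneq => ->; rewrite /link /= !addvv_F2 mem0v //.
  apply: (@leq_trans (\sum_(p | p.2 \in unlinked P p.1)
      \sum_(i in C | (p.1 \in e i) && (p.2 \in e i)) 1)%N).
    apply: leq_sum => p pU; rewrite muln1.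
    apply: (leq_trans (d2 [set p.1; p.2] _)); first by rewrite cards2 neq.
    rewrite sum1_card subset_leq_card //; apply/subsetP => i.
    rewrite inE subUset !sub1set => /andP[h1 h2]; rewrite -topredE /= h1 h2 !andbT.
    apply: contraLR (pU) => /outsidePn h; rewrite inE negbK.
    by apply/andP; split; apply: h; rewrite inE /= h1 h2; exact: neq.
  rewrite (exchange_big_dep (mem C)) => [|p i _ /andP[]//]; apply: leq_sum => i iC.
  rewrite sum1_card; apply: (@leq_trans (#|e i| * #|e i|.-1)).
    rewrite -card_offdiag subset_leq_card //; apply/subsetP => p.
    by rewrite -topredE inE /= => /andP[/neq -> /andP[_ /andP[-> ->]]].
  by apply: leq_mul => //; move: (rk i); case: #|e i| k0 => [|?]; case: (k).
rewrite leq_pmul2l // in count.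
have V0 : (0 < #|V|)%N by apply/card_gt0P; exists r.
(* With q the codimension of P, the chain is |V| q <= 2 (k - 1) |C| <= |V| |C|. *)
rewrite -leq_subLR -(leq_pmul2l V0); apply: (@leq_trans (\sum_u 2 * #|unlinked P u|)%N).
  rewrite -sum_nat_const; apply: leq_sum => u _.
  by rewrite leq_subLR; apply: dim_unlinked rP.
rewrite -big_distrr /=; apply: (@leq_trans (2 * (k.-1 * #|C|))); first by rewrite leq_mul2l count.
by rewrite mulnA leq_mul2r nk orbT.
Qed.

End Links.

(** * From a spanning transversal to an Euler tour *)

Section Tour.
Variables (V : finType) (m : nat) (e : 'I_m -> {set V}).
Let vT := {ffun bool * V -> ('F_2)^o}.
Local Open Scope ring_scope.

Lemma tour_of_pairs (a b : 'I_m -> V) : (0 < m)%N ->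
  (forall i, [/\ a i \in e i, b i \in e i & a i != b i]) ->
  (forall v, \sum_i ends a b i v = 0) ->
  (forall S : {set V}, S != set0 -> S != setT ->
     exists i, (a i \in S) != (b i \in S)) ->
  has_spanning_euler_tour e.
Proof.
move=> m0 ab even conn.
have [|w [cyc perm span]] := euler_circuit _ even conn; first by rewrite card_ord.
pose h d := (dart_src a b d, d.1 : 'I_m).
exists (map h w); split; first split.
- rewrite /closed_walk cycle_map; apply: sub_cycle cyc => x y /eqP xy.
  rewrite /= /walk_step /= -xy; case: x {xy} => i c.
  by have [h1 h2 h3] := ab i; case: c; rewrite /dart_src /dart_tgt /= ?h1 ?h2 //= eq_sym.
- by rewrite -map_comp (eq_map (g := fst)).
- by move=> v; rewrite -map_comp (eq_map (g := dart_src a b)).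
Qed.

Lemma sum_unit_vec (S : {set V}) i j :
  \sum_(v in S) unit_vec j (i, v) = ((j.1 == i) && (j.2 \in S))%:R :> 'F_2.
Proof.
case: j => i' v'; rewrite /=; have [<-|i'i] := eqVneq i' i; last first.
  by rewrite big1 // => v _; rewrite ffunE xpair_eqE eq_sym (negPf i'i).
case vS: (v' \in S).
  rewrite (bigD1 v') //= big1 => [|v /andP[_ vv']]; first by rewrite ffunE eqxx addr0.
  by rewrite ffunE xpair_eqE (negPf vv') andbF.
rewrite big1 // => v vS'; rewrite ffunE xpair_eqE.
case: (v =P v') => [vv'|_]; last by rewrite andbF.
by rewrite -vv' vS' in vS.
Qed.

(** This functional detects whether a link of colour i crosses the cut given by S. *)
Lemma sum_link (S : {set V}) i x :
  \sum_(v in S) link x (i, v) =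
  (x.1.1 == i)%:R * ((x.1.2 \in S)%:R + (x.2 \in S)%:R) :> 'F_2.
Proof.
under eq_bigr do rewrite ffunE; rewrite big_split /= !sum_unit_vec /=.
by case: eqP; rewrite ?mul1r // mul0r addr0.
Qed.

Lemma sum_link_all (i : bool) (x : bool * V * V) : \sum_v link x (i, v) = 0 :> 'F_2.
Proof.
transitivity (\sum_(v in [set: V]) link x (i, v) : 'F_2).
  by apply: eq_bigl => v; rewrite inE.
by rewrite sum_link !inE addrr_F2 mulr0.
Qed.

Lemma even_span (r : V) (f : 'I_m -> bool * V * V) :
  (root_span r + \sum_i <[link (f i)]>)%VS = fullv ->
  forall w : vT, (forall i, \sum_v w (i, v) = 0) ->
  exists c : 'I_m -> 'F_2, forall j, w j = \sum_i c i * link (f i) j.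
Proof.
move=> span w w0; have := memvf w; rewrite -span => /memv_addP[p pr [q /memv_sumP[s sf ->] wE]].
have /memv_addP[_ /vlineP[x ->] [_ /vlineP[y ->] pE]] := pr.
have /fin_all_exists[c cE] i : exists c : 'F_2, s i = c *: link (f i).
  by apply/vlineP; exact: sf.
have wjE j : w j = x * unit_vec (false, r) j + y * unit_vec (true, r) j +
    \sum_i c i * link (f i) j.
  rewrite wE pE [LHS]ffunE; congr (_ + _).
    by rewrite [LHS]ffunE; congr (_ + _); rewrite [LHS]ffunE.
  rewrite sum_ffunE.
  by apply: eq_bigr => i _; rewrite cE [LHS]ffunE.
(* Summing the coordinates of colour i kills w and all links, leaving only the root coefficient of
   that colour. *)
have xy i : (i == false)%:R * x + (i == true)%:R * y = 0.
  rewrite -[RHS](w0 i); under [RHS]eq_bigr do rewrite wjE.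
  rewrite !big_split /= exchange_big /= [X in _ = _ + X]big1 => [|j _].
    have toS F : \sum_v F v = \sum_(v in [set: V]) F v :> 'F_2.
      by apply: eq_bigl => v; rewrite inE.
    rewrite -!mulr_sumr !toS !sum_unit_vec !inE !andbT addr0.
    by congr (_ + _); rewrite mulrC eq_sym.
  by rewrite -mulr_sumr sum_link_all mulr0.
exists c => j; rewrite wjE.
have := xy false; have := xy true; rewrite !mul0r !mul1r add0r addr0 => -> ->.
by rewrite !mul0r !add0r.
Qed.

(* The [false] links make the chosen graph connected, the [true] links correct parities. *)
Lemma tour_of_span (r : V) (f : 'I_m -> bool * V * V) : (0 < m)%N ->
  (forall i, 2 < #|e i|)%N -> (forall i, f i \in choices e i) ->
  (root_span r + \sum_i <[link (f i)]>)%VS = fullv -> has_spanning_euler_tour e.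
Proof.
move=> m0 e3 fe /even_span span.
have fE i : [/\ (f i).1.2 \in e i, (f i).2 \in e i & (f i).1.2 != (f i).2].
  by have := fe i; rewrite inE => /and3P[].
have /fin_all_exists[z zE] i : exists z, [/\ z \in e i, z != (f i).1.2 & z != (f i).2].
  have /card_gt0P[z] : (0 < #|e i :\: [set (f i).1.2; (f i).2]|)%N.
    rewrite cardsD subn_gt0; apply: leq_ltn_trans (e3 i).
    by apply: leq_trans (subset_leq_card (subsetIr _ _)) _; rewrite cards2; case: (_ != _).
  by rewrite !inE negb_or => /andP[/andP[z1 z2] z3]; exists z.
(* A [true] hyperedge uses {z, u} or {z, u'}; changing the choice flips the parity at u and u'. *)
pose a i := if (f i).1.1 then z i else (f i).1.2.
pose s v : 'F_2 := \sum_i ends a (fun i => if (f i).1.1 then (f i).1.2 else (f i).2) i v.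
(* The degree parities [s] of the default choice, put in the [true] copy, have even weight; their
   coefficients [c] say which edges to flip. *)
have [|c cE] := span [ffun j => if j.1 then s j.2 else 0].
  case; last by rewrite big1 // => v _; rewrite ffunE.
  under eq_bigr do rewrite ffunE /=.
  rewrite exchange_big big1 // => i _; rewrite big_split /=.
  have one x : \sum_v (x == v)%:R = 1 :> 'F_2.
    rewrite (bigD1 x) //= eqxx big1 ?addr0 // => v; by rewrite eq_sym => /negPf ->.
  by rewrite !one addrr_F2.
pose b i := if (f i).1.1 then (if c i == 1 then (f i).2 else (f i).1.2) else (f i).2.
apply: (@tour_of_pairs a b) => // [i|v|S /set0Pn[x xS] SN].
- have [h1 h2 h3] := fE i; have [z1 z2 z3] := zE i.
  by rewrite /a /b; case: (f i).1.1 => //; case: (c i == 1).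
- have := cE (true, v); rewrite ffunE /= => sE.
  transitivity (s v + \sum_i c i * link (f i) (true, v)); last by rewrite -sE addrr_F2.
  rewrite -big_split /=; apply: eq_bigr => i _.
  rewrite /ends /a /b -addrA; congr (_ + _); rewrite !ffunE.
  case: (f i) => [[[] u] u']; rewrite !xpair_eqE /=; last by rewrite addr0 mulr0 addr0.
  rewrite (eq_sym v) (eq_sym v).
  have [->|c1] := eqVneq (c i) 1; first by rewrite mul1r addrA addrr_F2 add0r.
  have -> : c i = 0 by case: (c i) c1 => [[|[|[]]]] // ? _; exact: val_inj.
  by rewrite mul0r addr0.
- have /existsP[y yS] : [exists y, y \notin S].
    rewrite -negb_forall; apply: contraNN SN => /forallP yS; apply/eqP/setP => y.
    by rewrite yS inE.
  (* The [false] link xy crosses S. As a combination of the chosen links, it forces one of colour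
     [false] to cross S as well. *)
  have [c' c'E] := span _ (fun i => sum_link_all i (false, x, y)).
  apply/existsP; apply: contraT => /existsPn none.
  have := sum_link S false (false, x, y); rewrite /= xS (negPf yS) mul1r addr0.
  under eq_bigr do rewrite c'E; rewrite exchange_big big1 /= => [/eqP|i _].
    by rewrite eq_sym oner_eq0.
  rewrite -mulr_sumr sum_link; have := none i; rewrite negbK /a /b.
  by case: (f i).1.1 => /= [_|/eqP ->]; rewrite ?addrr_F2 ?mul0r ?mulr0.
Qed.

Lemma tour_of_delta2 k : (0 < m)%N -> (0 < #|V|)%N ->
  (forall i, 2 < #|e i| <= k)%N -> delta_ge e 2 k ->
  (2 * k.-1 <= #|V|)%N -> has_spanning_euler_tour e.
Proof.
move=> m0 /card_gt0P[r _] ek d2 nk.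
have k0 : (0 < k)%N by have /andP[/ltnW/ltnW] := ek (Ordinal m0); apply: leq_trans.
have cond : spanning_cond (@link V) (root_span r) (choices e).
  by apply: choices_spanning d2 nk => // i; have /andP[] := ek i.
have [i|f fe span] := rado_span _ cond.
  have /andP[/ltnW/card_gt1P[x [y [xe ye xy]]] _] := ek i.
  by apply/set0Pn; exists (false, x, y); rewrite inE /= xe ye.
by apply: tour_of_span fe span => // i; have /andP[] := ek i.
Qed.
End Tour.

(** * Pair degrees and lower bounds on n *)

Lemma delta_ge_extend (V : finType) m (e : 'I_m -> {set V}) t r :
  t <= r <= #|V| -> delta_ge e r 1 -> delta_ge e t 1.
Proof.
case/andP=> /subnKC <-; elim: (r - t) => [|d IHd]; rewrite ?addn0 // addnS => rV dr.
apply: IHd (ltnW rV) _ => T cT.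
have /card_gt0P[x] : 0 < #|~: T| by rewrite cardsCs setCK cT subn_gt0.
rewrite inE => xT; have := dr (x |: T); rewrite cardsU1 xT cT => /(_ erefl) /leq_trans; apply.
by apply: subset_leq_card; apply/subsetP => i; rewrite !inE subUset => /andP[].
Qed.

(** Each vertex outside T shares an edge with T, and an edge containing T has at most k - 2 further
    vertices. *)
Lemma deg2_of_delta3 (V : finType) m (e : 'I_m -> {set V}) k (T : {set V}) :
  (forall i, #|e i| <= k) -> delta_ge e 3 1 -> #|T| = 2 ->
  #|V| - 2 <= deg e T * (k - 2).
Proof.
move=> rk d3 cT.
have -> : #|V| - 2 = #|~: T| by rewrite cardsCs setCK cT.
rewrite -sum1_card /deg -sum_nat_const.
apply: (@leq_trans (\sum_(x in ~: T) \sum_(i in [set i | T \subset e i] | x \in e i) 1)).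
  apply: leq_sum => x xT; rewrite sum1_card.
  have := d3 (x |: T); rewrite cardsU1 cT -in_setC xT => /(_ erefl) /leq_trans; apply.
  apply: subset_leq_card; apply/subsetP => i.
  by rewrite !inE subUset sub1set => /andP[xi Ti]; rewrite unfold_in inE xi Ti.
rewrite (exchange_big_dep (mem [set i | T \subset e i])) => [|x i _ /andP[]//].
apply: leq_sum => i /=; rewrite inE => Ti; rewrite sum1_card.
apply: (@leq_trans #|e i :\: T|).
  apply: subset_leq_card; apply/subsetP => x.
  by rewrite unfold_in !inE => /and3P[-> _ ->].
rewrite cardsD (setIidPr Ti) cT; exact: leq_sub2r.
Qed.

(** The same count with ordered pairs of distinct vertices outside T. *)
Lemma deg2_of_delta4 (V : finType) m (e : 'I_m -> {set V}) k (T : {set V}) :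
  (forall i, #|e i| <= k) -> delta_ge e 4 1 -> #|T| = 2 ->
  (#|V| - 2) * (#|V| - 3) <= deg e T * ((k - 2) * (k - 3)).
Proof.
move=> rk d4 cT.
have -> : #|V| - 3 = (#|V| - 2).-1 by lia.
have -> : #|V| - 2 = #|~: T| by rewrite cardsCs setCK cT.
rewrite -card_offdiag -sum1_card /deg -sum_nat_const.
set Y := [set p | _].
apply: (@leq_trans (\sum_(p in Y)
    \sum_(i in [set i | T \subset e i] | (p.1 \in e i) && (p.2 \in e i)) 1)).
  apply: leq_sum => -[x y]; rewrite !inE /= => /and3P[xT yT xy]; rewrite sum1_card.
  have := d4 (x |: (y |: T)).
  rewrite !cardsU1 cT yT !inE negb_or xy xT => /(_ erefl) /leq_trans; apply.
  apply: subset_leq_card; apply/subsetP => i.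
  by rewrite !inE !subUset !sub1set => /and3P[xi yi Ti]; rewrite unfold_in inE xi yi Ti.
rewrite (exchange_big_dep (mem [set i | T \subset e i])) => [|x i _ /andP[]//].
apply: leq_sum => i /=; rewrite inE => Ti; rewrite sum1_card.
have cD : #|e i :\: T| <= k - 2.
  by rewrite cardsD (setIidPr Ti) cT; exact: leq_sub2r.
apply: (@leq_trans (#|e i :\: T| * #|e i :\: T|.-1)); last by apply: leq_mul; lia.
rewrite -card_offdiag; apply: subset_leq_card; apply/subsetP => p.
by rewrite unfold_in !inE => /andP[/and3P[-> -> ->] /andP[_ /andP[-> ->]]].
Qed.

(** In every case [g c k mu] is at least 'C(k, 2) + 1. *)
Lemma bin2_lt_of_g (c k mu n : nat) : 3 <= c <= k -> (g c k mu <= n%:R :> rat)%R ->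
  k * k.-1 < 2 * n.
Proof.
case/andP=> c3 ck.
have bin : 'C(k, 2) * 2 = k * k.-1.
  by elim: (k) => // -[|j] // IHj; rewrite binS bin1 mulnDl IHj /=; lia.
have binR : ('C(k, 2).+1%:R * 2 = k%:R * (k%:R - 1) + 2 :> rat)%R.
  case: k ck bin => [|k' _ bin]; first by lia.
  by rewrite -natrM mulSn bin natrD natrM -(natr1 k') addrK addrC.
suff le : ('C(k, 2).+1%:R <= g c k mu)%R.
  by move=> /(le_trans le); rewrite ler_nat; lia.
rewrite /g; case: ifP => [/andP[_ /eqP ->] //|c33].
case: ifP => [/andP[_ /eqP ->] //|c34].
case: ifP => [//|ck'].
case: ifP => [/andP[/andP[_ ge] le]|ck2].
  have D0 : (0 < (4 * c + 2)%:R - (2 * k)%:R :> rat)%R.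
    by rewrite subr_gt0 ltr_nat; lia.
  rewrite ler_pdivlMr //.
  have c1 : (3%:R <= c%:R :> rat)%R by rewrite ler_nat.
  (* The denominator is 2 or 4 respectively, which leaves a polynomial inequality in c. *)
  have [kE|kE] : k = 2 * c \/ k.+1 = 2 * c by lia.
    have kR : (k%:R = 2%:R * c%:R :> rat)%R by rewrite -natrM kE.
    by move: binR; rewrite !(natrD, natrM, natrX) kR => binR; nra.
  have kR : (k%:R = 2%:R * c%:R - 1 :> rat)%R by rewrite -natrM -kE -natr1 addrK.
  by move: binR; rewrite !(natrD, natrM, natrX) kR => binR; nra.
(* The default value 0 of [g] is never reached when 3 <= c <= k. *)
case: ifP => [/andP[_ lt]|]; last first.
  lia.
have le2 : (2 ^+ c <= 2 ^+ (k - c - 1) :> rat)%R by rewrite ler_weXn2l ?ler1n //; lia.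
rewrite lerDr mulr_ge0 ?ler0n //; lra.
Qed.

(** The left side grows like k^4 / 4, whereas d < k would bound the right side by (k - 1) (k - 2) (k
    - 3). *)
Lemma covering_bound (k n d : nat) : 4 <= k -> k * k.-1 < 2 * n ->
  (n - 2) * (n - 3) <= d * ((k - 2) * (k - 3)) -> k <= d.
Proof.
move=> k4; have [j ->] : exists j, k = j + 4 by exists (k - 4); lia.
move=> nj; have [s nE] : exists s, n = s + 3 by exists (n - 3); nia.
rewrite nE in nj *.
have -> : s + 3 - 2 = s.+1 by lia.
have -> : s + 3 - 3 = s by lia.
have -> : j + 4 - 2 = j.+2 by lia.
have -> : j + 4 - 3 = j.+1 by lia.
move=> h; rewrite leqNgt; apply/negP => dj.
have hd : d * (j.+2 * j.+1) <= (j + 3) * (j.+2 * j.+1) by rewrite leq_mul2r; lia.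
(* With k = j + 4 and n = s + 3, the bound k (k - 1) < 2 n reads q <= 2 s. *)
pose q := j * j + 7 * j + 7.
have jE : (j + 4).-1 = j + 3 by lia.
have hs : q <= 2 * s by move: nj; rewrite jE /q; lia.
have hq : q * (q + 2) <= 4 * ((j + 3) * (j.+2 * j.+1)).
  apply: leq_trans (leq_mul hs (leq_add hs (leqnn 2))) _.
  have -> : 2 * s * (2 * s + 2) = 4 * (s.+1 * s) by ring.
  by rewrite leq_mul2l (leq_trans h hd).
have qE : q * (q + 2) =
    4 * ((j + 3) * (j.+2 * j.+1)) + (j ^ 4 + 10 * j ^ 3 + 41 * j ^ 2 + 68 * j + 39).
  by rewrite /q; ring.
by move: hq; rewrite qE; lia.
Qed.

Theorem theorem1p2 (V : finType) (m : nat) (e : 'I_m -> {set V})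
  (n c k mu : nat) :
  admissible e n c k mu ->
  (delta_ge e 2 k \/
   (delta_ge e 3 1 /\ k ^ 2 - 3 * k + 5 <= n) \/
   (exists r, 4 <= r <= k /\ delta_ge e r 1)) ->
  has_spanning_euler_tour e.
Proof.
move=> [nV [_ [c3 [[[i0 ei0] crk] [[_ rk] [_ gn]]]]]] delta.
have ck : c <= k by rewrite -ei0.
have ck3 : 3 <= c <= k by rewrite c3.
have k3 : 3 <= k by exact: leq_trans ck.
have n_gt := bin2_lt_of_g ck3 gn.
apply: (@tour_of_delta2 _ _ e k).
- by case: i0 {ei0} => i /(leq_ltn_trans (leq0n _)).
- by rewrite nV; nia.
- by move=> i; rewrite rk andbT; exact: leq_trans (crk i).
- case: delta => [//|[[d3 nk]|[r [/andP[r4 rk'] dr]]]] T cT.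
  (* Here n - 2 >= k^2 - 3 k + 3 > (k - 1) (k - 2), so the degree exceeds k - 1. *)
  + have := deg2_of_delta3 rk d3 cT; rewrite nV; nia.
  + have d4 : delta_ge e 4 1.
      apply: delta_ge_extend dr; rewrite r4 nV; nia.
    have := deg2_of_delta4 rk d4 cT; rewrite nV; exact: covering_bound (leq_trans r4 rk') n_gt.
(* For k >= 4 use k (k - 1) >= 4 (k - 1); for k = 3, the strict bound gives n >= 4. *)
- rewrite nV; nia.
Qed.
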